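(* Let $r$ be a nonnegative integer, $\lambda\in\mathbb{R}$, and $n\ge k\ge0$. Then $${n+r \brack k+r}_{r,\lambda}=\sum_{i=k}^{n}(-1)^{i-k}(-r)_{i-k,\lambda}{n \brack i}_{\lambda}\binom{i}{k},$$ and $${n+r \brace k+r}_{r,\lambda}=\sum_{i=k}^{n}\binom{n}{i}(r)_{n-i,\lambda}S_{2,\lambda}(i,k).$$
   Context: $(x)_{0,\lambda}=1$, $(x)_{n,\lambda}=x(x-\lambda)\cdots(x-(n-1)\lambda)$; $\langle x\rangle_{0,\lambda}=1$, $\langle x\rangle_{n,\lambda}=x(x+\lambda)\cdots(x+(n-1)\lambda)$; $(x)_n=(x)_{n,1}$, $\langle x\rangle_n=\langle x\rangle_{n,1}$. The degenerate unsigned Stirling numbers of the first kind ${n \brack k}_\lambda$ are defined by $\langle x\rangle_n=\sum_{k=0}^n{n \brack k}_\lambda\langle x\rangle_{k,\lambda}$; the degenerate Stirling numbers of the second kind by $(x)_{n,\lambda}=\sum_{k=0}^n S_{2,\lambda}(n,k)(x)_k$. The unsigned degenerate $r$-Stirling numbers of the first kind are defined by $\langle x+r\rangle_n=\sum_{k=0}^n{n+r \brack k+r}_{r,\lambda}\langle x\rangle_{k,\lambda}$, and the degenerate $r$-Stirling numbers of the second kind by $(x+r)_{n,\lambda}=\sum_{k=0}^n{n+r \brace k+r}_{r,\lambda}(x)_k$ (all polynomial identities in $x$). *)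

(* Defs.v *)
From HB Require Import structures.
From mathcomp Require Import all_boot all_order all_algebra.
From mathcomp Require Import boolp classical_sets reals.
Set Implicit Arguments.
Unset Strict Implicit.
Unset Printing Implicit Defensive.
Import Order.TTheory GRing.Theory Num.Theory.
Local Open Scope ring_scope.

(* (x)_{n,lam} and <x>_{n,lam}. They are stated over any commutative ring so
   that x may be a number or a polynomial such as 'X or 'X + r. *)
Definition dfall (A : comNzRingType) (lam x : A) (n : nat) : A :=
  \prod_(j < n) (x - j%:R * lam).

Definition drise (A : comNzRingType) (lam x : A) (n : nat) : A :=
  \prod_(j < n) (x + j%:R * lam).

Section Expansion.
Variable R : realType.
Implicit Types (b : nat -> {poly R}) (p : {poly R}) (c : nat -> R).

(* The clause for k > n is the usual convention that the numbers vanish out of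
   range; it makes the coefficient family unique. *)
Definition is_expansion b n p c : Prop :=
  p = \sum_(k < n.+1) c k *: b k /\ (forall k, (n < k)%N -> c k = 0).

Definition expansion_coef b n p : nat -> R :=
  xget (fun=> 0) [set c | is_expansion b n p c].

Definition graded b := forall k, size (b k) = k.+1.

Lemma expansion_ex b n p :
  graded b -> (size p <= n.+1)%N -> exists c, is_expansion b n p c.
Proof.
move=> gb; elim: n p => [|n IHn] p sp.
  have b0 := gb 0; have /size_poly1P[u u0 bE] : size (b 0) == 1 by rewrite b0.
  exists (fun k => if k == 0 then p`_0 / u else 0); split; last by case.
  by rewrite big_ord1 /= bE -mul_polyC -polyCM divfK // -size1_polyC.
have ln0 : lead_coef (b n.+1) != 0 by rewrite lead_coef_eq0 -size_poly_eq0 gb.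
pose a := p`_n.+1 / lead_coef (b n.+1).
have [|c [cE c0]] := IHn (p - a *: b n.+1).
  apply/leq_sizeP => j; rewrite leq_eqVlt => /orP[/eqP <-|lj].
    move: ln0; rewrite /a /lead_coef gb /= => ln0.
    by rewrite coefB coefZ divfK ?subrr.
  by rewrite coefB coefZ !nth_default ?mulr0 ?subrr ?gb //; apply: leq_trans sp _.
exists (fun k => if k == n.+1 then a else c k); split.
  rewrite big_ord_recr /= eqxx -[LHS](subrK (a *: b n.+1)) cE; congr (_ + _).
  by apply: eq_bigr => i _; rewrite ltn_eqF.
by move=> k lk; rewrite gtn_eqF // c0 // ltnW.
Qed.

Lemma graded_free b n c : graded b ->
  \sum_(k < n) c k *: b k = 0 -> forall k, (k < n)%N -> c k = 0.
Proof.
move=> gb; elim: n => // n IHn; rewrite big_ord_recr /= => s0.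
have cn : c n = 0.
  move/(congr1 (fun q : {poly R} => q`_n)): (s0).
  rewrite coefD coef_sum big1 ?add0r => [|i _]; last first.
    by rewrite coefZ nth_default ?mulr0 // gb.
  rewrite coefZ coef0 => /eqP; rewrite mulf_eq0 => /orP[/eqP //|/eqP bn].
  have : lead_coef (b n) = 0 by rewrite /lead_coef gb.
  by move/eqP; rewrite lead_coef_eq0 -size_poly_eq0 gb.
move: s0; rewrite cn scale0r addr0 => s0 k; rewrite ltnS leq_eqVlt.
by case/orP => [/eqP -> //|]; apply: IHn.
Qed.

Lemma expansion_uniq b n p c c' : graded b ->
  is_expansion b n p c -> is_expansion b n p c' -> c =1 c'.
Proof.
move=> gb [cE c0] [cE' c0'] k; case: (ltnP n k) => [lk|]; first by rewrite c0 ?c0'.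
rewrite -ltnS => lk; apply/eqP; rewrite -subr_eq0; apply/eqP.
apply: (@graded_free b n.+1 (fun k => c k - c' k)) => //.
under eq_bigr do rewrite scalerBl.
by rewrite sumrB -cE -cE' subrr.
Qed.

Lemma expansion_coefP b n p : graded b -> (size p <= n.+1)%N ->
  is_expansion b n p (expansion_coef b n p).
Proof. by move=> gb /(expansion_ex gb)[c Pc]; apply: (@xgetI _ _ _ c). Qed.

(* In the r-versions the arguments are those displayed in the brackets, i.e.
   n + r and k + r, so that stirling1r lam r (n + r) (k + r) is the number
   with top entry n + r and bottom entry k + r; entries below r are
   meaningless, since natural subtraction truncates. *)
Definition stirling1 (lam : R) (n k : nat) : R :=
  expansion_coef (drise lam%:P 'X) n (drise 1 'X n) k.

Definition stirling2 (lam : R) (n k : nat) : R :=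
  expansion_coef (dfall 1 'X) n (dfall lam%:P 'X n) k.

Definition stirling1r (lam : R) (r m l : nat) : R :=
  expansion_coef (drise lam%:P 'X) (m - r)
    (drise 1 ('X + r%:R) (m - r)) (l - r).

Definition stirling2r (lam : R) (r m l : nat) : R :=
  expansion_coef (dfall 1 'X) (m - r)
    (dfall lam%:P ('X + r%:R) (m - r)) (l - r).

Lemma drise_size (lam a : R) n : size (drise lam%:P ('X + a%:P) n) = n.+1.
Proof.
rewrite /drise (eq_bigr (fun j : 'I_n => 'X - (- (a + j%:R * lam))%:P)).
  by rewrite size_prod_XsubC /index_enum -enumT size_enum_ord.
by move=> i _; rewrite polyCN opprK polyCD polyCM polyC_natr addrA.
Qed.

Lemma dfall_size (lam a : R) n : size (dfall lam%:P ('X + a%:P) n) = n.+1.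
Proof.
rewrite -(drise_size (- lam) a n) /drise /dfall; congr (size (polyseq _)).
by apply: eq_bigr => i _; rewrite polyCN mulrN.
Qed.

Lemma drise_graded (lam : R) : graded (drise lam%:P 'X).
Proof. by move=> k; rewrite -['X]addr0 drise_size. Qed.

Lemma dfall_graded (lam : R) : graded (dfall lam%:P 'X).
Proof. by move=> k; rewrite -['X]addr0 dfall_size. Qed.

Lemma stirling1E (lam : R) n :
  drise 1 'X n = \sum_(k < n.+1) stirling1 lam n k *: drise lam%:P 'X k.
Proof.
by apply: (expansion_coefP _ _).1; [exact: drise_graded | rewrite drise_graded].
Qed.

Lemma stirling2E (lam : R) n :
  dfall lam%:P 'X n = \sum_(k < n.+1) stirling2 lam n k *: dfall 1 'X k.
Proof.
by apply: (expansion_coefP _ _).1; [exact: dfall_graded | rewrite dfall_graded].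
Qed.

Lemma stirling1rE (lam : R) r n :
  drise 1 ('X + r%:R) n =
  \sum_(k < n.+1) stirling1r lam r (n + r) (k + r) *: drise lam%:P 'X k.
Proof.
rewrite /stirling1r addnK; under eq_bigr do rewrite addnK.
apply: (expansion_coefP _ _).1; first exact: drise_graded.
by rewrite -polyC_natr drise_size.
Qed.

Lemma stirling2rE (lam : R) r n :
  dfall lam%:P ('X + r%:R) n =
  \sum_(k < n.+1) stirling2r lam r (n + r) (k + r) *: dfall 1 'X k.
Proof.
rewrite /stirling2r addnK; under eq_bigr do rewrite addnK.
apply: (expansion_coefP _ _).1; first exact: dfall_graded.
by rewrite -polyC_natr dfall_size.
Qed.

End Expansion.

(* Main.v *)
(* Substituting 'X + r in the defining expansions and splitting the factorial of
   the sum by the degenerate Vandermonde identity expands the polynomials defining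
   the r-Stirling numbers in the same basis; as that basis is graded, coefficients
   can be compared. *)
Require Import Defs.
From HB Require Import structures.
From mathcomp Require Import all_boot all_order all_algebra.
From mathcomp Require Import boolp classical_sets reals.
From mathcomp Require Import ring.
Import Order.TTheory GRing.Theory Num.Theory.
Local Open Scope ring_scope.

Lemma dfallS (A : comNzRingType) (lam x : A) n :
  dfall lam x n.+1 = dfall lam x n * (x - n%:R * lam).
Proof. by rewrite /dfall big_ord_recr. Qed.

(** Degenerate Vandermonde, by induction: against the [i]-th term the new factor
    [x + y - n%:R * lam] splits as [x - i%:R * lam] plus [y - (n - i)%:R * lam], each extending one
    of the two factorials. *)
Lemma dfall_add (A : comNzRingType) (lam x y : A) n :
  dfall lam (x + y) n =
  \sum_(i < n.+1) 'C(n, i)%:R * dfall lam x i * dfall lam y (n - i).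
Proof.
elim: n => [|n IHn].
  by rewrite big_ord1 /dfall !big_ord0 bin0 !mulr1.
rewrite dfallS IHn big_distrl /=.
transitivity (\sum_(i < n.+1) 'C(n, i)%:R * dfall lam x i.+1 * dfall lam y (n - i)
   + \sum_(i < n.+1) 'C(n, i)%:R * dfall lam x i * dfall lam y (n.+1 - i)).
  rewrite -big_split /=; apply: eq_bigr => i _.
  have lein : (i <= n)%N by rewrite -ltnS.
  rewrite subSn // !dfallS -[in n%:R * lam](subnKC lein) natrD.
  by ring.
(* Pascal's rule on the terms of positive index matches the two sums. *)
rewrite [RHS]big_ord_recl /= bin0.
under [X in _ = _ + X]eq_bigr => i _ do
  rewrite /bump /= add1n binS natrD subSS !mulrDl.
rewrite big_split /= addrA [RHS]addrC; congr (_ + _).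
(* The surplus top term on the right carries ['C(n, n.+1)], which is zero. *)
rewrite big_ord_recl bin0 [in RHS]big_ord_recr /= bin_small // !mul0r addr0.
by congr (_ + _); apply: eq_bigr => i _; rewrite /bump /= add1n subSS.
Qed.

Lemma drise_dfall (A : comNzRingType) (lam x : A) n :
  drise lam x n = dfall (- lam) x n.
Proof. by apply: eq_bigr => i _; rewrite mulrN opprK. Qed.

(** Negating each of the [n] factors gives the sign; this is where the sign and the argument
    [- r%:R] of the first formula come from. *)
Lemma drise_dfallN (A : comNzRingType) (lam x : A) n :
  drise lam x n = (-1) ^+ n * dfall lam (- x) n.
Proof.
rewrite -[n in _ ^+ n]card_ord -prodrN; apply: eq_bigr => i _.
by rewrite opprB addrC opprK.
Qed.

(** Serves both substitution, with [f] a composition of polynomials, and the embedding of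
    constants. *)
Lemma rmorph_dfall (A B : comNzRingType) (f : {rmorphism A -> B}) (lam x : A) n :
  f (dfall lam x n) = dfall (f lam) (f x) n.
Proof.
rewrite rmorph_prod; apply: eq_bigr => i _.
by rewrite rmorphB rmorphM rmorph_nat.
Qed.

Lemma rmorph_drise (A B : comNzRingType) (f : {rmorphism A -> B}) (lam x : A) n :
  f (drise lam x n) = drise (f lam) (f x) n.
Proof. by rewrite !drise_dfall rmorph_dfall rmorphN. Qed.

Lemma drise_add (A : comNzRingType) (lam x y : A) n :
  drise lam (x + y) n =
  \sum_(i < n.+1) 'C(n, i)%:R * drise lam x i * drise lam y (n - i).
Proof.
by rewrite drise_dfall dfall_add; apply: eq_bigr => i _; rewrite !drise_dfall.
Qed.

Lemma graded_coef_inj (R : realType) (b : nat -> {poly R}) n (c c' : nat -> R) :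
  graded b ->
  \sum_(k < n.+1) c k *: b k = \sum_(k < n.+1) c' k *: b k ->
  forall k, (k <= n)%N -> c k = c' k.
Proof.
move=> gb E k lkn; apply/eqP; rewrite -subr_eq0; apply/eqP.
apply: (@graded_free R b n.+1 (fun k => c k - c' k)) => //.
under eq_bigr do rewrite scalerBl.
by rewrite sumrB E subrr.
Qed.

Lemma triangular_scale_sum (R : nzRingType) (V : lmodType R) (b : nat -> V) n
    (a : nat -> nat -> R) :
  \sum_(i < n.+1) \sum_(k < i.+1) a i k *: b k =
  \sum_(k < n.+1) (\sum_(k <= i < n.+1) a i k) *: b k.
Proof.
transitivity (\sum_(i < n.+1) \sum_(k < n.+1 | (k <= i)%N) a i k *: b k).
  apply: eq_bigr => i _.
  by rewrite (big_ord_widen n.+1 (fun k => a i k *: b k)).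
rewrite (exchange_big_dep predT) //=; apply: eq_bigr => k _.
by rewrite scaler_suml big_geq_mkord.
Qed.

Theorem theorem5 (R : realType) (lam : R) (r n k : nat) (hkn : (k <= n)%N) :
  stirling1r lam r (n + r) (k + r) =
    \sum_(k <= i < n.+1)
      (-1) ^+ (i - k) * dfall lam (- r%:R) (i - k) * stirling1 lam n i
        * 'C(i, k)%:R
  /\
  stirling2r lam r (n + r) (k + r) =
    \sum_(k <= i < n.+1)
      'C(n, i)%:R * dfall lam r%:R (n - i) * stirling2 lam i k.
Proof.
split.
  pose c k := stirling1r lam r (n + r) (k + r).
  pose a i k := (-1) ^+ (i - k) * dfall lam (- r%:R) (i - k) * stirling1 lam n i
        * 'C(i, k)%:R.
  apply: (@graded_coef_inj R _ n c (fun k => \sum_(k <= i < n.+1) a i k)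
    (drise_graded lam)) hkn.
  rewrite -stirling1rE -triangular_scale_sum.
  (* Here expansion precedes Vandermonde: the shift is pushed through the expansion of
     [drise 1 'X n], and each shifted basis element is then split. *)
  have -> : drise 1 ('X + r%:R) n = drise 1 'X n \Po ('X + r%:R) :> {poly R}.
    by rewrite (rmorph_drise _ _ (comp_poly ('X + r%:R))) rmorph1 /= comp_polyX.
  rewrite (stirling1E lam) raddf_sum; apply: eq_bigr => i _ /=.
  rewrite comp_polyZ (rmorph_drise _ _ (comp_poly ('X + r%:R))) /= comp_polyC.
  rewrite comp_polyX drise_add scaler_sumr; apply: eq_bigr => j _.
  (* The Vandermonde factor in [r] is a constant polynomial, hence part of the coefficient. *)
  rewrite /a -drise_dfallN -!polyC_natr -rmorph_drise.
  by rewrite -!mul_polyC !polyCM; ring.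
pose c k := stirling2r lam r (n + r) (k + r).
pose a i k := 'C(n, i)%:R * dfall lam r%:R (n - i) * stirling2 lam i k.
have := dfall_graded (1 : R); rewrite polyC1 => g1.
apply: (@graded_coef_inj R _ n c (fun k => \sum_(k <= i < n.+1) a i k) g1) hkn.
(* Now Vandermonde comes first, since ['X + r%:R] already has step [lam]; only the factor in ['X] is
   then expanded. *)
rewrite -stirling2rE -triangular_scale_sum dfall_add; apply: eq_bigr => i _.
rewrite stirling2E mulr_sumr mulr_suml; apply: eq_bigr => j _.
rewrite /a -!polyC_natr -rmorph_dfall.
by rewrite -!mul_polyC !polyCM; ring.
Qed.
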